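(* Let $J\in\{[0,\infty),\mathbb{R}\}$, let $X$ be a real Banach space and let $E=X\oplus iX$ be its complexification. Let $\mathfrak{g}(t)=e^{it^2}$ for $t\in\mathbb{R}$. If $\phi:J\to E$ is a function such that $\Delta_s(\mathfrak{g}\phi)\in\mathfrak{g}\,UC(J,E)$ for each $s>0$, then $\phi=u+(1/\mathfrak{g})\xi$ with $u\in BUC(J,E)$ and $\xi\in\Delta C_0(J,E)$.
   Context: $E=X\oplus iX$ is the complex linear space with multiplication $(a+ib)(y_1+iy_2)=(ay_1-by_2)+i(by_1+ay_2)$, endowed with the (product) topology of the norm $\|y_1+iy_2\|=\max\{\|y_1\|,\|y_2\|\}$ (or any of the equivalent norms $(\|y_1\|^p+\|y_2\|^p)^{1/p}$, $1\le p<\infty$). For $f:J\to E$ and $s>0$, $(\Delta_s f)(t)=f(t+s)-f(t)$. $UC(J,E)$, $BUC(J,E)$, $C_0(J,E)$ denote the spaces of uniformly continuous (not necessarily bounded), bounded uniformly continuous, and continuous vanishing at infinity functions $J\to E$; $\mathfrak{g}\,UC(J,E)=\{\mathfrak{g}u:u\in UC(J,E)\}$; and $\Delta C_0(J,E)=\{\phi\in L^1_{loc}(J,E): \Delta_h\phi\in C_0(J,E)\text{ for all }h>0\}$. *)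

(* Defs.v *)
From HB Require Import structures.
From mathcomp Require Import all_boot all_order all_algebra.
From mathcomp Require Import all_classical all_reals all_analysis.
From mathcomp Require Import complex.

Set Implicit Arguments.
Unset Strict Implicit.
Unset Printing Implicit Defensive.
Import Order.TTheory GRing.Theory Num.Theory.
Import numFieldNormedType.Exports.
Local Open Scope classical_set_scope.
Local Open Scope ring_scope.

(* The complexification X (+) iX has carrier X * X, the pair (y1, y2) standing
   for y1 + i y2; the library's norm on a product is max(|y1|, |y2|).

   A function J -> E is represented by a total function R -> E; every notion
   below depends only on its values on J. *)

Section Complexification.
Context {R : realType} {X : normedModType R}.

Definition cscale (z : R[i]) (y : X * X) : X * X :=
  (complex.Re z *: y.1 - complex.Im z *: y.2,
   complex.Im z *: y.1 + complex.Re z *: y.2).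

End Complexification.

Notation "z *c: y" := (cscale z y) (at level 40).

(* t |-> exp (i t^2) *)
Definition chirp {R : realType} (t : R) : R[i] :=
  Complex (cos (t ^+ 2)) (sin (t ^+ 2)).

Section FunctionSpaces.
Context {R : realType} {E : normedModType R}.
Implicit Types (J : set R) (f : R -> E).

Definition Delta (s : R) f : R -> E := fun t => f (t + s) - f t.

(* The uniformity of [subspace J] is the trace on J of that of R, made discrete
   off J, so values outside J impose no condition. *)
Definition UC J f : Prop := unif_continuous (f : subspace J -> E).

Definition BUC J f : Prop := UC J f /\ [bounded f t | t in J].

Definition C0 J f : Prop :=
  {within J, continuous f} /\
  forall e : R, 0 < e ->
    exists M : R, forall t, J t -> M < `|t| -> `|f t| < e.

Definition simple (s : R -> E) : Prop :=
  finite_set (range s) /\ forall y, measurable (s @^-1` [set y]).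

Definition strongly_measurable J f : Prop :=
  exists s : (R -> E)^nat, (forall n, simple (s n)) /\
    {ae lebesgue_measure, forall t : R, J t -> s n t @[n --> \oo] --> f t}.

(* Local Bochner integrability. [strongly_measurable] only makes the norm of f
   Lebesgue measurable, but the library's integral of a nonnegative function is
   a supremum over the simple functions below it, which for such functions is
   the Lebesgue integral. *)
Definition L1loc J f : Prop :=
  strongly_measurable J f /\
  forall K : set R, compact K -> K `<=` J ->
    (\int[lebesgue_measure]_(t in K) (`|f t|)%:E < +oo)%E.

Definition DeltaC0 J f : Prop :=
  L1loc J f /\ forall h : R, 0 < h -> C0 J (Delta h f).

End FunctionSpaces.

Definition chirpUC {R : realType} {X : normedModType R} (J : set R)
    (f : R -> X * X) : Prop :=
  exists2 v : R -> X * X, UC J v & forall t, J t -> f t = chirp t *c: v t.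

(* Main.v *)
Require Import Defs.
From HB Require Import structures.
From mathcomp Require Import all_boot all_order all_algebra.
From mathcomp Require Import all_classical all_reals all_analysis.
From mathcomp Require Import complex ring lra.
Import Order.TTheory GRing.Theory Num.Theory.
Import numFieldNormedType.Exports.
Local Open Scope classical_set_scope.
Local Open Scope ring_scope.

(* Put F = g phi and Delta_s F = g v_s with v_s in UC; comparing v_(s+1) - v_1
   with v_s shows that each v_s is bounded. The oscillation of g makes the
   integral of g v over [t, t + h] tend to 0 for v in BUC: translating by
   r = pi / (2|t|) changes the sign of g up to o(1). Hence the integrals of
   Delta_h F over [t, t + l] and of Delta_l F over [t, t + h], whose difference
   does not depend on t, coincide. No regularity of F is assumed, but by Baire
   v_s is equicontinuous and bounded, up to e, for a dense set of s in some
   interval I; averaging Delta_s Delta_h F over s in I then bounds Delta_h F,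
   and F is continuous. Now xi(t) is the integral of F over [t, t + 1], and
   Delta_h xi is the integral of Delta_h F = g v_h. Finally u = (F - xi) / g is
   in BUC: replacing [t, t + 1] by a window t + I' with I' inside I changes xi
   by o(1) and turns u into - (the mean of v_s over s in I'), whose modulus of
   continuity is controlled by e. *)

Set Implicit Arguments.
Unset Strict Implicit.

(** * Primitives and integrals of vector-valued functions *)

Section ProductComplete.
Context {K : numFieldType} {U V : completeNormedModType K}.

HB.instance Definition _ := Pointed.on (U * V)%type.

(** Both projections of a Cauchy filter are Cauchy, and the pair of their limits is a limit.
    Completeness of [X * X] is what makes the integrals below exist. *)
Let prod_complete (F : set_system (U * V)%type) :
  ProperFilter F -> cauchy F -> cvg F.
Proof.
move=> FF /cauchyP cF.
have c1 : cvg (fst @ F).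
  apply/cauchy_cvgP/cauchyP; move=> e e0; have := cF _ e0; move=> [[x y] Fxy].
  exists x; apply: (@filterS _ F _ (ball (x, y) e) _ _ Fxy).
  by move=> z [].
have c2 : cvg (snd @ F).
  apply/cauchy_cvgP/cauchyP; move=> e e0; have := cF _ e0; move=> [[x y] Fxy].
  exists y; apply: (@filterS _ F _ (ball (x, y) e) _ _ Fxy).
  by move=> z [].
apply/cvg_ex; exists (lim (fst @ F), lim (snd @ F)).
have := @cvg_pair _ _ _ F (nbhs (lim (fst @ F))) (nbhs (lim (snd @ F)))
  _ (nbhs_filter _) (nbhs_filter _) fst snd c1 c2.
move=> c12 A /c12; rewrite /nbhs/= => h.
by apply: (@filterS _ F _ _ A _ h) => -[].
Qed.

HB.instance Definition _ := Uniform_isComplete.Build (U * V)%type prod_complete.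

End ProductComplete.

(** * Linear identities in a module, by reflection *)

Section ModuleReflection.
Context {R : comPzRingType} {V : lmodType R}.

Inductive mexpr :=
  MVar of nat | MZero | MAdd of mexpr & mexpr | MOpp of mexpr
| MScale of R & mexpr.

Fixpoint meval (env : seq V) m : V := match m with
  | MVar n => env`_n | MZero => 0 | MAdd a b => meval env a + meval env b
  | MOpp a => - meval env a | MScale c a => c *: meval env a end.

Fixpoint mcoef n m : R := match m with
  | MVar k => if eqn n k then 1 else 0 | MZero => 0
  | MAdd a b => mcoef n a + mcoef n b
  | MOpp a => - mcoef n a | MScale c a => c * mcoef n a end.

Lemma mevalE env m :
  meval env m = \sum_(i < size env) mcoef i m *: env`_i.
Proof.
elim: m => /= [n||a -> b ->|a ->|c a ->].
- case: (ltnP n (size env)) => hn.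
    rewrite (bigD1 (Ordinal hn))//= eqnE eqxx scale1r big1 ?addr0// => i.
    by rewrite -val_eqE/= => /negbTE ->; rewrite scale0r.
  rewrite nth_default// big1// => i _; rewrite eqnE.
  by rewrite ltn_eqF ?scale0r// (leq_trans (ltn_ord i)).
- by rewrite big1// => i _; rewrite scale0r.
- by rewrite -big_split; apply: eq_bigr => i _; rewrite scalerDl.
- by rewrite -sumrN; apply: eq_bigr => i _; rewrite scaleNr.
- by rewrite scaler_sumr; apply: eq_bigr => i _; rewrite scalerA.
Qed.

(** Recursion on the number of atoms lets [cbn] unfold this into a finite conjunction of identities
    for [ring]. *)
Fixpoint mcoef_eq n a b : Prop :=
  if n is k.+1 then mcoef k a = mcoef k b /\ mcoef_eq k a b else True.

Lemma meval_eq env a b : mcoef_eq (size env) a b -> meval env a = meval env b.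
Proof.
rewrite !mevalE => h; apply: eq_bigr => -[i ni] _ /=; congr (_ *: _).
elim: (size env) ni h => //= n ih; rewrite ltnS leq_eqVlt => /predU1P[->|ni].
  by case.
by case=> _; exact: ih.
Qed.

End ModuleReflection.

Ltac matom env x :=
  match env with
  | nil => constr:(cons x nil)
  | cons ?y _ => let _ := match goal with _ => unify x y end in env
  | cons ?y ?t => let t' := matom t x in constr:(cons y t')
  end.
Ltac mindex env x :=
  match env with
  | cons ?y _ => let _ := match goal with _ => unify x y end in constr:(O)
  | cons _ ?t => let n := mindex t x in constr:(S n)
  end.
Ltac matoms env m :=
  match m with
  | (?a + ?b)%R => let e := matoms env a in matoms e b
  | (- ?a)%R => matoms env a
  | (_ *: ?a)%R => matoms env a
  | 0%R => env
  | _ => matom env m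
  end.
Ltac mquote R env m :=
  match m with
  | (?a + ?b)%R =>
      let a' := mquote R env a in let b' := mquote R env b in
      constr:(@MAdd R a' b')
  | (- ?a)%R => let a' := mquote R env a in constr:(@MOpp R a')
  | (?c *: ?a)%R => let a' := mquote R env a in constr:(@MScale R c a')
  | 0%R => constr:(@MZero R)
  | _ => let n := mindex env m in constr:(@MVar R n)
  end.
(* [ring] does not apply to modules: compare the coefficients of each atom. *)
Ltac module R :=
  match goal with |- ?a = ?b :> ?T =>
    let e := matoms (@nil T) a in let e := matoms e b in
    let a' := mquote R e a in let b' := mquote R e b in
    apply: (@meval_eq R _ e a' b'); cbn [size mcoef_eq mcoef eqn];
    repeat split; try ring
  end.

(** * Cousin's lemma: from local to global on a segment *)

Section Cousin.
Context {R : realType}.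
Implicit Types (a b t x y z : R).

(** Let [c] be the supremum of the points reachable from [a]. The local hypothesis at [c] joins a
    reachable point just below [c] to a point beyond [c], unless [c = b]. *)
Lemma cousin (Q : R -> R -> Prop) a b : a <= b ->
  (forall x y z, a <= x -> x <= y -> y <= z -> z <= b ->
     Q x y -> Q y z -> Q x z) ->
  (forall t, a <= t <= b -> exists2 d, 0 < d &
     forall x y, a <= x -> x <= t -> t <= y -> y <= b ->
       t - x < d -> y - t < d -> Q x y) ->
  Q a b.
Proof.
move=> ab Qtrans Qloc.
pose A := [set x | a <= x <= b /\ Q a x].
have Aa : A a.
  split; first by rewrite lexx.
  have [|d d0] := Qloc a; first by rewrite lexx.
  by apply; rewrite ?subrr.
have hA : has_sup A.
  by split; [exists a|exists b => x [/andP[]]].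
pose c := sup A.
have ac : a <= c by apply: (ub_le_sup hA.2).
have cb : c <= b by apply: ge_sup; [exists a | move=> x [/andP[]]].
have [|d d0 Qd] := Qloc c; first by rewrite ac.
have [x [/andP[ax xb] Qax] cx] := sup_adherent d0 hA.
have xc : x <= c by apply: (ub_le_sup hA.2); split=> //; apply/andP.
pose y := Num.min b (c + d / 2).
have cy : c <= y by rewrite /y le_min cb /= lerDl; lra.
have yb : y <= b by rewrite /y ge_min lexx.
have yc2 : y <= c + d / 2 by rewrite /y ge_min lexx orbT.
have Qay : Q a y.
  apply: (Qtrans a x y) => //; first exact: le_trans cy.
  apply: Qd => //; move: cx yc2; rewrite -/c; lra.
have yc : y <= c.
  by apply: (ub_le_sup hA.2); split=> //; rewrite yb (le_trans ac cy).
have -> : b = y; last by [].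
move: yc; rewrite /y ge_min => /orP[bc|]; last by lra.
by rewrite min_l //; lra.
Qed.

End Cousin.

Section Primitive.
Context {R : realType} {V : normedModType R}.
Implicit Types (f g P : R -> V) (a b c e t s : R).

Definition cont_on f a b := forall t, a <= t <= b -> forall e, 0 < e ->
  exists2 d, 0 < d & forall s, a <= s <= b -> `|s - t| < d -> `|f s - f t| <= e.

(* [P] is a primitive of [f] up to an error [e] in the slope; primitives are
   limits of such [P] as [e] tends to [0]. *)
Definition eprim e f P a b := forall t, a <= t <= b ->
  exists2 d, 0 < d & forall s, a <= s <= b -> `|s - t| < d ->
    `|P s - P t - (s - t) *: f t| <= e * `|s - t|.

Definition prim f P a b := forall e, 0 < e -> eprim e f P a b.

(** A mean value inequality: the bound is additive over adjacent intervals and holds near each point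
    by comparing slopes, so [cousin] applies. *)
Lemma eprim_dist e e' M f g P Q a b : a <= b ->
  eprim e f P a b -> eprim e' g Q a b ->
  (forall t, a <= t <= b -> `|f t - g t| <= M) ->
  `|(P b - P a) - (Q b - Q a)| <= (e + e' + M) * (b - a).
Proof.
move=> ab hP hQ hM.
apply: (@cousin _ (fun x y => `|(P y - P x) - (Q y - Q x)| <= (e + e' + M) * (y - x)))
  => // [x y z _ _ _ _ h1 h2|t tab].
  have -> : P z - P x - (Q z - Q x) =
    (P y - P x - (Q y - Q x)) + (P z - P y - (Q z - Q y)).
    by module R.
  by rewrite (le_trans (ler_normD _ _))//; lra.
have [d d0 hd] := hP _ tab; have [d' d'0 hd'] := hQ _ tab.
have loc s : a <= s <= b -> `|s - t| < Num.min d d' ->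
    `|(P s - P t) - (Q s - Q t)| <= (e + e' + M) * `|s - t|.
  move=> sab; rewrite lt_min => /andP[/(hd _ sab) h1 /(hd' _ sab) h2].
  have -> : P s - P t - (Q s - Q t) = (P s - P t - (s - t) *: f t)
      - (Q s - Q t - (s - t) *: g t) + (s - t) *: (f t - g t).
    by module R.
  rewrite (le_trans (ler_normD _ _))// (le_trans (lerD (ler_normB _ _) (lexx _)))//.
  rewrite normrZ !mulrDl; have := hM _ tab.
  by have := normr_ge0 (s - t); nra.
exists (Num.min d d'); first by rewrite lt_min d0.
move=> x y ax xt ty yb tx yt.
have := loc x; rewrite ax (le_trans xt)//=; last by case/andP: tab.
have := loc y; rewrite yb (le_trans _ ty)//=; last by case/andP: tab.
rewrite (distrC x) !ger0_norm ?subr_ge0// => /(_ isT yt) h1 /(_ isT tx) h2.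
have -> : P y - P x - (Q y - Q x) =
  (P y - P t - (Q y - Q t)) - (P x - P t - (Q x - Q t)) by module R.
by rewrite (le_trans (ler_normB _ _))//; lra.
Qed.

Lemma eprim_sub e f P a b a' b' : a <= a' -> b' <= b ->
  eprim e f P a b -> eprim e f P a' b'.
Proof.
move=> aa bb h t /andP[ta tb].
have [|d d0 hd] := h t; first by rewrite (le_trans aa)// (le_trans tb).
exists d => // s /andP[sa sb]; apply: hd.
by rewrite (le_trans aa)// (le_trans sb).
Qed.

(** The second piece is translated to agree with [P1] at [c]; there the left estimate comes from
    [P1] and the right one from [P2]. *)
Lemma eprim_glue e f P1 P2 a c b : a <= c -> c <= b ->
  eprim e f P1 a c -> eprim e f P2 c b ->
  eprim e f (fun s => if s <= c then P1 s else P1 c + P2 s - P2 c) a b.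
Proof.
move=> ac cb h1 h2 t /andP[at_ tb].
have [tc|ct|tc] := ltgtP t c.
- have [|d d0 hd] := h1 t; first by rewrite at_ ltW.
  exists (Num.min d (c - t)); first by rewrite lt_min d0 subr_gt0.
  move=> s /andP[sa sb]; rewrite lt_min => /andP[std stc].
  have sc : s <= c by move: stc; rewrite ltr_norml; lra.
  by rewrite sc; apply: hd; rewrite ?sa.
- have [|d d0 hd] := h2 t; first by rewrite tb ltW.
  exists (Num.min d (t - c)); first by rewrite lt_min d0 subr_gt0.
  move=> s /andP[sa sb]; rewrite lt_min => /andP[std stc].
  have cs : c < s by move: stc; rewrite ltr_norml; lra.
  rewrite (leNgt s) cs /=.
  have -> : P1 c + P2 s - P2 c - (P1 c + P2 t - P2 c) = P2 s - P2 t by module R.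
  by apply: hd; rewrite ?sb ?ltW.
- rewrite tc.
  have [|d d0 hd] := h1 c; first by rewrite ac lexx.
  have [|d' d'0 hd'] := h2 c; first by rewrite cb lexx.
  exists (Num.min d d'); first by rewrite lt_min d0.
  move=> s /andP[sa sb]; rewrite lt_min => /andP[std std'].
  have [sc|cs] := leP s c; first by apply: hd; rewrite ?sa.
  have -> : P1 c + P2 s - P2 c - P1 c = P2 s - P2 c by module R.
  by apply: hd'; rewrite ?sb ?ltW.
Qed.

(** Close to [t] the linear map of slope [f t] will do, and [cousin] glues such pieces. *)
Lemma eprim_ex e f a b : a <= b -> 0 < e -> cont_on f a b ->
  exists P, eprim e f P a b.
Proof.
move=> ab e0 cf.
apply: (@cousin _ (fun x y => exists P, eprim e f P x y)) => //.
  move=> x y z _ xy yz _ [P1 h1] [P2 h2].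
  by eexists; exact: eprim_glue h1 h2.
move=> t tab; have [|d d0 hd] := cf t tab (e / 2); first by lra.
exists d => // x y ax xt ty yb tx yt.
exists (fun s => s *: f t) => r /andP[xr ry].
exists 1 => // s /andP[xs sy] _.
have -> : s *: f t - r *: f t - (s - r) *: f r = (s - r) *: (f t - f r).
  by rewrite scalerBr !scalerBl.
rewrite normrZ mulrC ler_wpM2r// distrC (le_trans (hd _ _ _))//.
- by rewrite (le_trans ax)// (le_trans ry).
- by rewrite ltr_norml; lra.
- by lra.
Qed.

End Primitive.

Lemma natSinv_lt {R : realType} (e : R) : 0 < e ->
  exists N : nat, forall n, (N <= n)%N -> n.+1%:R^-1 < e.
Proof.
move=> e0; exists (Num.truncn e^-1) => n Nn.
rewrite -[ltRHS]invrK ltf_pV2 ?posrE ?invr_gt0//.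
apply: (lt_le_trans (truncnS_gt _)).
by rewrite ler_nat.
Qed.

(** * The integral of a continuous function, as the increment of a primitive *)

Section Integral.
Context {R : realType} {V : completeNormedModType R}.
Implicit Types (f g P : R -> V) (a b c e t s : R).

(** Approximate primitives [p n] with slope error [1/(n+1)], normalized to vanish at [a], are
    pointwise Cauchy by [eprim_dist]. Their increments converge at a rate proportional to the length
    of the interval, so the slope estimate passes to the limit. *)
Lemma prim_ex f a b : a <= b -> cont_on f a b -> exists P, prim f P a b.
Proof.
move=> ab cf.
have /choice[p hp] : forall n : nat, exists P,
    P a = 0 /\ eprim n.+1%:R^-1 f P a b.
  move=> n; have [|P hP] := @eprim_ex _ _ n.+1%:R^-1 _ _ _ ab _ cf.
    by rewrite invr_gt0.
  exists (fun s => P s - P a); split=> [|t /hP[d d0 hd]]; first by rewrite subrr.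
  exists d => // s sab std; rewrite (_ : _ - _ - (P t - P a) = P s - P t).
    exact: hd.
  by module R.
have pdist n m s t : a <= t -> t <= s -> s <= b ->
    `|(p n s - p n t) - (p m s - p m t)| <= (n.+1%:R^-1 + m.+1%:R^-1) * `|s - t|.
  move=> at_ ts sb.
  rewrite -[X in X * _]addr0 (@ger0_norm _ (s - t)) ?subr_ge0//.
  apply: (@eprim_dist _ _ _ _ _ f f) => //.
  - by apply: eprim_sub (hp n).2.
  - by apply: eprim_sub (hp m).2.
  - by move=> x _; rewrite subrr normr0.
have pcvg t : a <= t <= b -> cvg (p n t @[n --> \oo]).
  move=> /andP[at_ tb]; apply: cauchy_cvg; apply: cauchy_exP => e e0.
  have [|N hN] := @natSinv_lt R (e / (2 * (b - a + 1))).
    by rewrite divr_gt0//; lra.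
  exists (p N t), N => // n /= Nn.
  rewrite -ball_normE /=.
  have := @pdist N n t a (lexx _) at_ tb.
  rewrite !(hp _).1 !subr0 => /le_lt_trans; apply.
  have {}hN k : (N <= k)%N -> k.+1%:R^-1 * (2 * (b - a + 1)) < e.
    by move=> /hN; rewrite ltr_pdivlMr//; lra.
  have h1 := hN _ (leqnn N); have h2 := hN _ Nn.
  rewrite ger0_norm ?subr_ge0//.
  have : 0 <= N.+1%:R^-1 :> R by rewrite invr_ge0.
  have : 0 <= n.+1%:R^-1 :> R by rewrite invr_ge0.
  move: h1 h2; set x := N.+1%:R^-1; set y := n.+1%:R^-1 => h1 h2 y0 x0.
  have : (x + y) * (t - a) <= (x + y) * (b - a + 1).
    by apply: ler_wpM2l; lra.
  by nra.
pose P t := lim (p n t @[n --> \oo]).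
have hP : forall n s t, a <= t <= b -> a <= s <= b ->
    `|(P s - P t) - (p n s - p n t)| <= 2 * n.+1%:R^-1 * `|s - t|.
  move=> n s t; wlog ts : s t / t <= s.
    move=> h tab sab; have [|/ltW] := leP t s; first by move=> ?; exact: h.
    move=> /h /(_ sab tab); rewrite (distrC t s); apply: le_trans.
    by rewrite -normrN le_eqVlt; apply/orP; left; apply/eqP; congr (`|_|); module R.
  move=> /andP[at_ tb] /andP[as_ sb]; apply/ler_addgt0Pr => e e0.
  have e20 : 0 < e / 2 by lra.
  have hs : p m s @[m --> \oo] --> P s by apply: pcvg; rewrite as_.
  have ht : p m t @[m --> \oo] --> P t by apply: pcvg; rewrite at_.
  move/cvgrPdist_lt: hs => /(_ _ e20)[N _ hN].
  move/cvgrPdist_lt: ht => /(_ _ e20)[N' _ hN'].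
  pose m := maxn n (maxn N N').
  have nm : (n <= m)%N by rewrite leq_maxl.
  have := hN m; rewrite /= leq_max leq_maxl orbT => /(_ isT) h1.
  have := hN' m; rewrite /= leq_max leq_maxr orbT => /(_ isT) h2.
  have h3 := @pdist m n s t at_ ts sb.
  rewrite (_ : _ - _ = (P s - p m s) - (P t - p m t) +
    (p m s - p m t - (p n s - p n t))); last by module R.
  rewrite (le_trans (ler_normD _ _))// (le_trans (lerD (ler_normB _ _) h3))//.
  have : m.+1%:R^-1 <= n.+1%:R^-1 :> R by rewrite lef_pV2 ?posrE// ler_nat.
  move=> /(ler_wpM2r (normr_ge0 (s - t))).
  by move: (m.+1%:R^-1 : R) (n.+1%:R^-1 : R) => x y; lra.
exists P => e e0 t tab.
(* Two thirds of the error come from replacing [P] by [p N], one third from the slope error of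
   [p N]. *)
have [|N hN] := @natSinv_lt R (e / 3); first by lra.
have {}hN := hN _ (leqnn N).
have [d d0 hd] := (hp N).2 t tab; exists d => // s sab std.
have h1 := hP N s t tab sab; have h2 := hd s sab std.
rewrite (_ : _ - _ = (P s - P t - (p N s - p N t)) +
  (p N s - p N t - (s - t) *: f t)); last by module R.
rewrite (le_trans (ler_normD _ _))//.
move: (N.+1%:R^-1 : R) hN h1 h2 => x xe h1 h2.
have : x * `|s - t| <= e / 3 * `|s - t| by rewrite ler_wpM2r// ltW.
by lra.
Qed.

(** The primitive is picked by choice, with the zero function as default; the value is meaningful
    when [a <= b] and [f] has a primitive on that segment. *)
Definition integ f a b : V :=
  let P := xget (fun=> 0) [set P | prim f P a b] in P b - P a.

Lemma integE f P a b : a <= b -> prim f P a b -> integ f a b = P b - P a.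
Proof.
move=> ab hP; rewrite /integ; case: xgetP => [Q _ hQ|/(_ P)//].
apply/eqP; rewrite -subr_eq0 -normr_le0; apply/ler_addgt0Pr => e e0.
(* The [+ 1] keeps the denominator positive when [a = b]. *)
have k0 : 0 < e / (2 * (b - a + 1)) by rewrite divr_gt0//; lra.
have := @eprim_dist _ _ _ _ 0 f f Q P a b ab (hQ _ k0) (hP _ k0).
move=> h; apply: le_trans (h _) _; first by move=> t _; rewrite subrr normr0.
rewrite addr0 add0r.
rewrite (_ : e / _ + e / _ = e / (b - a + 1)); last by field; lra.
rewrite -mulrAC ler_pdivrMr; [nra|lra].
Qed.

Lemma prim_sub f P a b a' b' : a <= a' -> b' <= b ->
  prim f P a b -> prim f P a' b'.
Proof. by move=> aa bb h e /h; exact: eprim_sub. Qed.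

Lemma integ_chasles f a c b : a <= c -> c <= b -> cont_on f a b ->
  integ f a b = integ f a c + integ f c b.
Proof.
move=> ac cb cf; have ab := le_trans ac cb.
have [P hP] := prim_ex ab cf.
rewrite (integE ab hP) (integE ac (prim_sub (lexx _) cb hP)).
rewrite (integE cb (prim_sub ac (lexx _) hP)).
by module R.
Qed.

Lemma integ_dist M f g a b : a <= b -> cont_on f a b -> cont_on g a b ->
  (forall t, a <= t <= b -> `|f t - g t| <= M) ->
  `|integ f a b - integ g a b| <= M * (b - a).
Proof.
move=> ab cf cg h.
have [P hP] := prim_ex ab cf; have [Q hQ] := prim_ex ab cg.
rewrite (integE ab hP) (integE ab hQ).
apply/ler_addgt0Pr => e e0.
have k0 : 0 < e / (2 * (b - a + 1)) by rewrite divr_gt0//; lra.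
have := eprim_dist ab (hP _ k0) (hQ _ k0) h; move/le_trans; apply.
rewrite mulrDl addrC lerD2l//.
rewrite (_ : e / _ + e / _ = e / (b - a + 1)); last by field; lra.
rewrite -mulrAC ler_pdivrMr; [nra|lra].
Qed.

Lemma eq_integ f g a b : a <= b -> cont_on f a b ->
  (forall t, a <= t <= b -> f t = g t) -> integ f a b = integ g a b.
Proof.
move=> ab cf fg; have cg : cont_on g a b.
  move=> t tab e e0; have [d d0 h] := cf t tab e e0.
  by exists d => // s sab; rewrite -!fg//; exact: h.
apply/eqP; rewrite -subr_eq0 -normr_le0 -[leRHS](mul0r (b - a)).
by apply: integ_dist => // t tab; rewrite fg// subrr normr0.
Qed.

Lemma integ_shift c f a b : a <= b -> cont_on f (a + c) (b + c) ->
  integ (fun t => f (t + c)) a b = integ f (a + c) (b + c).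
Proof.
move=> ab cf; have abc : a + c <= b + c by lra.
have [P hP] := prim_ex abc cf.
rewrite (integE abc hP) (@integE _ (fun t => P (t + c)))//.
move=> e e0 t tab; have [|d d0 hd] := hP e e0 (t + c); first by lra.
exists d => // s sab; have := hd (s + c).
by rewrite (_ : s + c - (t + c) = s - t); [apply; lra|ring].
Qed.

Lemma integ_cst (v : V) a b : a <= b -> integ (fun=> v) a b = (b - a) *: v.
Proof.
move=> ab; rewrite (@integE _ (fun t => t *: v))// ?scalerBl//.
move=> e e0 t _; exists 1 => // s _ _.
by rewrite scalerBl subrr normr0 mulr_ge0// ltW.
Qed.

Lemma integB f g a b : a <= b -> cont_on f a b -> cont_on g a b ->
  integ (fun t => f t - g t) a b = integ f a b - integ g a b.
Proof.
move=> ab cf cg.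
have [P hP] := prim_ex ab cf; have [Q hQ] := prim_ex ab cg.
rewrite (integE ab hP) (integE ab hQ).
rewrite (@integE _ (fun t => P t - Q t))//; first by module R.
move=> e e0 t tab; have e20 : 0 < e / 2 by lra.
have [d d0 h1] := hP _ e20 t tab; have [d' d'0 h2] := hQ _ e20 t tab.
exists (Num.min d d'); first by rewrite lt_min d0.
move=> s sab; rewrite lt_min => /andP[/(h1 _ sab) {}h1 /(h2 _ sab) {}h2].
rewrite (_ : _ - _ = (P s - P t - (s - t) *: f t)
  - (Q s - Q t - (s - t) *: g t)); last by module R.
by rewrite (le_trans (ler_normB _ _))//; lra.
Qed.

Lemma integ_linear (L : V -> V) (K : R) f a b : a <= b -> cont_on f a b ->
  (forall x y, L (x - y) = L x - L y) -> (forall r x, L (r *: x) = r *: L x) ->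
  0 < K -> (forall x, `|L x| <= K * `|x|) ->
  integ (L \o f) a b = L (integ f a b).
Proof.
move=> ab cf LB LZ K0 LK; have [P hP] := prim_ex ab cf.
rewrite (integE ab hP) (@integE _ (L \o P)) ?LB//.
move=> e e0 t tab; have [|d d0 hd] := hP (e / K) _ t tab; first exact: divr_gt0.
exists d => // s sab /(hd _ sab) h /=.
rewrite -!LB -LZ -LB (le_trans (LK _))//.
by rewrite -ler_pdivlMl// mulrA (mulrC K^-1).
Qed.

End Integral.

(** * Rotations and function classes *)

Lemma cos_lipschitz1 {R : realType} (x z : R) : `|cos x - cos z| <= `|x - z|.
Proof.
wlog zx : x z / z <= x.
  by move=> h; case: (leP z x) => [/h//|/ltW/h]; rewrite distrC (distrC z).
have [|c _ ->] := @MVT_segment _ cos (fun t => - sin t) _ _ zx.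
  by apply: continuous_subspaceT; exact: continuous_cos.
by rewrite normrM normrN -[leRHS]mul1r ler_wpM2r// sin_max.
Qed.

Lemma sin_lipschitz1 {R : realType} (x z : R) : `|sin x - sin z| <= `|x - z|.
Proof.
wlog zx : x z / z <= x.
  by move=> h; case: (leP z x) => [/h//|/ltW/h]; rewrite distrC (distrC z).
have [|c _ ->] := @MVT_segment _ sin cos _ _ zx.
  by apply: continuous_subspaceT; exact: continuous_sin.
by rewrite normrM -[leRHS]mul1r ler_wpM2r// cos_max.
Qed.

Section Rotation.
Context {R : realType} {X : normedModType R}.
Implicit Types (x z r : R) (y w : X * X).

(* multiplication by exp (i x) *)
Definition crot x y : X * X := Complex (cos x) (sin x) *c: y.

Lemma crotD x z y : crot x (crot z y) = crot (x + z) y.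
Proof.
rewrite /crot /cscale /= cosD sinD.
by congr (_, _) => /=; module R.
Qed.

Lemma crot0 y : crot 0 y = y.
Proof.
by rewrite /crot /cscale cos0 sin0; case: y => a b; congr (_, _) => /=; module R.
Qed.

Lemma crotK x y : crot (- x) (crot x y) = y.
Proof. by rewrite crotD addNr crot0. Qed.

Lemma crotB x y w : crot x (y - w) = crot x y - crot x w.
Proof. by rewrite /crot /cscale /=; congr (_, _) => /=; module R. Qed.

Lemma crotDr x y w : crot x (y + w) = crot x y + crot x w.
Proof. by rewrite /crot /cscale /=; congr (_, _) => /=; module R. Qed.

Lemma crotZ x r y : crot x (r *: y) = r *: crot x y.
Proof. by rewrite /crot /cscale /=; congr (_, _) => /=; module R. Qed.

Lemma crotDpi x y : crot (x + pi) y = - crot x y.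
Proof.
by rewrite /crot /cscale cosDpi sinDpi /=; congr (_, _) => /=; module R.
Qed.

Lemma crotDNpi x y : crot (x - pi) y = - crot x y.
Proof. by rewrite -[in RHS](subrK pi x) crotDpi opprK. Qed.

(** For the max norm, multiplication by a unimodular number need not be isometric. This is the
    source of the factor 2 in the estimates below. *)
Let scale_norm (a b k : R) y : `|a| <= k -> `|b| <= k ->
  `|(a *: y.1 - b *: y.2, b *: y.1 + a *: y.2)| <= 2 * k * `|y|.
Proof.
move=> ak bk; rewrite !prod_normE/= ge_max.
have h1 : `|y.1| <= Num.max `|y.1| `|y.2| by rewrite le_max lexx.
have h2 : `|y.2| <= Num.max `|y.1| `|y.2| by rewrite le_max lexx orbT.
rewrite (le_trans (ler_normB _ _)) ?(le_trans (ler_normD _ _))// !normrZ.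
all: rewrite -mulrA mulr_natl mulr2n; apply: lerD; apply: ler_pM => //.
Qed.

Lemma norm_crot x y : `|crot x y| <= 2 * `|y|.
Proof.
by rewrite -[X in X * _]mulr1; apply: scale_norm; rewrite (cos_max, sin_max).
Qed.

Lemma crot_lipschitz x z y : `|crot x y - crot z y| <= 2 * `|x - z| * `|y|.
Proof.
rewrite (_ : _ - _ = ((cos x - cos z) *: y.1 - (sin x - sin z) *: y.2,
    (sin x - sin z) *: y.1 + (cos x - cos z) *: y.2)); last first.
  by rewrite /crot /cscale; congr (_, _) => /=; module R.
by apply: scale_norm; [exact: cos_lipschitz1|exact: sin_lipschitz1].
Qed.

Lemma chirpVE (t : R) y : (chirp t)^-1 *c: y = crot (- t ^+ 2) y.
Proof.
suff -> : (chirp t)^-1 = Complex (cos (- t ^+ 2)) (sin (- t ^+ 2)) by [].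
have c0 : chirp t != 0.
  rewrite /chirp eq_complex /= -(sqrf_eq0 (cos _)) -(sqrf_eq0 (sin _)).
  by rewrite -paddr_eq0 ?sqr_ge0// cos2Dsin2 oner_eq0.
apply: (mulfI c0); rewrite mulfV//.
rewrite /chirp cosN sinN; apply/eqP; rewrite eq_complex /= mulrN opprK -!expr2.
by rewrite cos2Dsin2 mulrN mulrC addNr !eqxx.
Qed.

End Rotation.

(** * Uniform continuity, boundedness and decay in epsilon-delta form *)

Section FunctionClasses.
Context {R : realType} {V : completeNormedModType R}.
Implicit Types (J : set R) (f g : R -> V) (a b c e h t x y B C M : R).

Definition uc J f := forall e, 0 < e -> exists2 d, 0 < d &
  forall x y, J x -> J y -> `|x - y| < d -> `|f x - f y| <= e.

(** Uniform continuity on bounded parts of [J]. Unlike [uc], it survives multiplication by the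
    chirp, whose phase is Lipschitz only on bounded sets. *)
Definition luc J f := forall B e, 0 < e -> exists2 d, 0 < d &
  forall x y, J x -> J y -> `|x| <= B -> `|y| <= B -> `|x - y| < d ->
    `|f x - f y| <= e.

Definition bdd J f := exists C, forall t, J t -> `|f t| <= C.

Definition vanish J f := forall e, 0 < e -> exists M, forall t, J t ->
  M < `|t| -> `|f t| <= e.

(** The common feature of the half-line and the line on which the decomposition rests. *)
Definition shift_closed J := forall t s, J t -> 0 <= s -> J (t + s).

Lemma shift_closed_le J a t : shift_closed J -> J a -> a <= t -> J t.
Proof. by move=> sJ Ja at_; rewrite -(subrKC a t); apply: sJ; rewrite ?subr_ge0. Qed.

Lemma uc_luc J f : uc J f -> luc J f.
Proof. by move=> h B e /h[d d0 hd]; exists d => // x y Jx Jy _ _; exact: hd. Qed.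

Lemma bdd_gt0 J f : bdd J f -> exists2 C, 0 < C & forall t, J t -> `|f t| <= C.
Proof.
move=> [C hC]; exists (Num.max C 1); first by rewrite lt_max ltr01 orbT.
by move=> t /hC tC; rewrite le_max tC.
Qed.

Lemma luc_cont_on J f a b : shift_closed J -> luc J f -> J a -> cont_on f a b.
Proof.
move=> sJ lf Ja t /andP[at_ tb] e e0.
have [d d0 hd] := lf (`|a| + `|b|) e e0.
have cmp s : a <= s -> s <= b -> `|s| <= `|a| + `|b|.
  move=> as_ sb; have := ler_norm b; have := ler_norm (- a).
  by rewrite normrN ler_norml => ? ?; have := normr_ge0 a; have := normr_ge0 b; lra.
exists d => // s /andP[as_ sb] std.
by apply: hd => //; (exact: shift_closed_le Ja _) || exact: cmp.
Qed.

Lemma luc_bounded J f B : luc J f ->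
  exists C, forall t, J t -> `|t| <= B -> `|f t| <= C.
Proof.
move=> lf; have [B0|B0] := ltP B 0.
  by exists 0 => t _ tB; have := normr_ge0 t; lra.
have [d d0 hd] := lf B 1 ltr01.
suff [C hC] : exists C, forall t, - B <= t <= B -> J t -> `|f t| <= C.
  by exists C => t Jt; rewrite ler_norml => /hC; exact.
apply: (@cousin _ (fun x y => exists C, forall t, x <= t <= y -> J t -> `|f t| <= C)).
- by lra.
- move=> x y z _ xy yz _ [C hC] [C' hC'].
  exists (Num.max C C') => t /andP[xt tz] Jt; rewrite le_max.
  have [ty|/ltW yt] := leP t y; first by rewrite hC// xt.
  by rewrite hC' ?orbT// yt.
- move=> t tB; exists (d / 2); first by lra.
  move=> x y Bx xt ty yB tx yt.
  (* The segment may miss [J]. Otherwise [s0] is a reference point within [d] of all points of the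
     segment. *)
  have [[s0 /andP[xs0 s0y] Js0]|no] := pselect (exists2 s, x <= s <= y & J s).
    exists (`|f s0| + 1) => s /andP[xs sy] Js.
    rewrite -[f s](subrKC (f s0)) (le_trans (ler_normD _ _))// lerD2l.
    by apply: hd => //; rewrite ?ler_norml ?ltr_norml; lra.
  by exists 0 => s xsy Js; exfalso; apply: no; exists s.
Qed.

Lemma lucB J f g : luc J f -> luc J g -> luc J (fun t => f t - g t).
Proof.
move=> lf lg B e e0; have e20 : 0 < e / 2 by lra.
have [d d0 hd] := lf B _ e20; have [d' d'0 hd'] := lg B _ e20.
exists (Num.min d d'); first by rewrite lt_min d0.
move=> x y Jx Jy xB yB; rewrite lt_min => /andP[xyd xyd'].
rewrite (_ : _ - _ = (f x - f y) - (g x - g y)); last by module R.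
rewrite (le_trans (ler_normB _ _))//.
by have := hd _ _ Jx Jy xB yB xyd; have := hd' _ _ Jx Jy xB yB xyd'; lra.
Qed.

Lemma luc_shift J f h : shift_closed J -> 0 <= h -> luc J f ->
  luc J (fun t => f (t + h)).
Proof.
move=> sJ h0 lf B e e0; have [d d0 hd] := lf (B + h) _ e0.
exists d => // x y Jx Jy xB yB xyd; apply: hd; try exact: sJ.
- by rewrite (le_trans (ler_normD _ _))// (ger0_norm h0) lerD2r.
- by rewrite (le_trans (ler_normD _ _))// (ger0_norm h0) lerD2r.
- by rewrite (_ : _ - _ = x - y)//; ring.
Qed.

Lemma eq_luc J f g : (forall t, J t -> f t = g t) -> luc J f -> luc J g.
Proof.
move=> fg lf B e /(lf B)[d d0 hd]; exists d => // x y Jx Jy.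
by rewrite -!fg//; exact: hd.
Qed.

Lemma vanishB J f g : vanish J f -> vanish J g -> vanish J (fun t => f t - g t).
Proof.
move=> vf vg e e0; have e20 : 0 < e / 2 by lra.
have [M hM] := vf _ e20; have [M' hM'] := vg _ e20.
exists (Num.max M M') => t Jt; rewrite gt_max => /andP[Mt M't].
rewrite (le_trans (ler_normB _ _))//.
by have := hM _ Jt Mt; have := hM' _ Jt M't; lra.
Qed.

Lemma vanishN J f : vanish J f -> vanish J (fun t => - f t).
Proof. by move=> vf e /vf[M hM]; exists M => t Jt /(hM t Jt); rewrite normrN. Qed.

Lemma eq_vanish J f g : (forall t, J t -> f t = g t) -> vanish J f -> vanish J g.
Proof.
by move=> fg vf e /vf[M hM]; exists M => t Jt Mt; rewrite -fg//; exact: hM.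
Qed.

Lemma vanish_shift J f h : shift_closed J -> 0 <= h -> vanish J f ->
  vanish J (fun t => f (t + h)).
Proof.
move=> sJ h0 vf e /vf[M hM]; exists (M + h) => t Jt Mt.
apply: hM; first exact: sJ.
by have := ler_normB (t + h) h; rewrite addrK (ger0_norm h0); lra.
Qed.

(** The step [c] is cut into [n] steps shorter than [d], each changing [f] by at most 1, with [n]
    independent of [t]. *)
Lemma uc_step J f c : shift_closed J -> 0 <= c -> uc J f ->
  bdd J (fun t => f (t + c) - f t).
Proof.
move=> sJ c0 uf; have [d d0 hd] := uf _ ltr01.
pose n := (Num.truncn (c / d)).+1; pose k := c / n%:R.
have n0 : 0 < n%:R :> R by rewrite ltr0n.
have k0 : 0 <= k by rewrite divr_ge0// ltW.
have kd : k < d.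
  by rewrite ltr_pdivrMr// mulrC -ltr_pdivrMr// truncnS_gt.
have step m t : J t -> `|f (t + m%:R * k) - f t| <= m%:R.
  move=> Jt; elim: m => [|m ih]; first by rewrite mul0r addr0 subrr normr0.
  have mk0 : 0 <= m%:R * k by rewrite mulr_ge0.
  rewrite (_ : _ - _ = (f (t + m.+1%:R * k) - f (t + m%:R * k)) +
    (f (t + m%:R * k) - f t)); last by module R.
  rewrite (le_trans (ler_normD _ _))// -natr1 [leRHS]addrC lerD//.
  apply: hd; [apply: sJ => //; nra | exact: sJ|].
  by rewrite (_ : _ - _ = k) ?ger0_norm//; ring.
exists n%:R => t Jt; have := step n t Jt.
by rewrite /k mulrCA mulfV ?mulr1// gt_eqF.
Qed.

Lemma cont_onB f g a b : cont_on f a b -> cont_on g a b ->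
  cont_on (fun t => f t - g t) a b.
Proof.
move=> cf cg t tab e e0; have e20 : 0 < e / 2 by lra.
have [d d0 hd] := cf t tab _ e20; have [d' d'0 hd'] := cg t tab _ e20.
exists (Num.min d d'); first by rewrite lt_min d0.
move=> s sab; rewrite lt_min => /andP[/(hd _ sab) h1 /(hd' _ sab) h2].
rewrite (_ : _ - _ = (f s - f t) - (g s - g t)); last by module R.
by rewrite (le_trans (ler_normB _ _))//; lra.
Qed.

Lemma cont_on_cst (y : V) a b : cont_on (fun=> y) a b.
Proof. by move=> t _ e e0; exists 1 => // s _ _; rewrite subrr normr0 ltW. Qed.

Lemma cont_on_shift f c a b : cont_on f (a + c) (b + c) ->
  cont_on (fun t => f (t + c)) a b.
Proof.
move=> cf t tab e e0; have [|d d0 hd] := cf (t + c) _ e e0; first by lra.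
exists d => // s sab std; apply: hd; first by lra.
by rewrite (_ : _ - _ = s - t)//; ring.
Qed.

Lemma cont_on_lipschitz (L : V -> V) (K : R) f a b : 0 < K ->
  (forall p q : V, `|L p - L q| <= K * `|p - q|) -> cont_on f a b ->
  cont_on (L \o f) a b.
Proof.
move=> K0 LK cf t tab e e0.
have [|d d0 hd] := cf t tab (e / K); first exact: divr_gt0.
exists d => // s sab /(hd _ sab) h; rewrite (le_trans (LK _ _))//.
by rewrite mulrC -ler_pdivlMr.
Qed.

Lemma integ_bound M f a b : a <= b -> cont_on f a b ->
  (forall t, a <= t <= b -> `|f t| <= M) -> `|integ f a b| <= M * (b - a).
Proof.
move=> ab cf hM; have := @integ_dist _ _ M f (fun=> 0) a b ab cf.
rewrite integ_cst// scaler0 subr0; apply; first exact: cont_on_cst.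
by move=> t /hM; rewrite subr0.
Qed.

Lemma integN f a b : a <= b -> cont_on f a b ->
  integ (fun t => - f t) a b = - integ f a b.
Proof.
move=> ab cf; have -> : (fun t => - f t) = (fun v => - v) \o f by [].
rewrite (@integ_linear _ _ _ 1)//.
- by move=> x y; module R.
- by move=> r x; module R.
- by move=> x; rewrite mul1r normrN.
Qed.

(** Carries the bounds that Baire's theorem gives for a dense set of parameters to the whole
    interval. *)
Lemma norm_le_dense (P : R -> Prop) C f a b : a < b -> cont_on f a b ->
  (forall x y, a <= x -> x < y -> y <= b -> exists2 s, x < s < y & P s) ->
  (forall s, a <= s <= b -> P s -> `|f s| <= C) ->
  forall s, a <= s <= b -> `|f s| <= C.
Proof.
move=> ab cf dP hP s /[dup] sab /andP[as_ sb]; apply/ler_addgt0Pr => e e0.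
have [d d0 hd] := cf s sab e e0.
(* The interval lies just to the right of [s], or just to its left when [s = b]. *)
have [x [y [ax xy yb xyd]]] : exists x y, [/\ a <= x, x < y, y <= b &
    forall r, x < r < y -> `|r - s| < d].
  have [sltb|bs] := ltP s b.
    exists s, (Num.min b (s + d)); rewrite lt_min sltb ltrDl d0 ge_min lexx.
    by split=> // r; rewrite lt_min ltr_norml => /andP[? /andP[? ?]]; lra.
  exists (Num.max a (s - d)), s; rewrite gt_max le_max lexx sb.
  have -> : a < s by lra.
  split=> //; first by lra.
  by move=> r; rewrite gt_max ltr_norml => /andP[/andP[? ?] ?]; lra.
have [r /andP[xr ry] Pr] := dP x y ax xy yb.
have rab : a <= r <= b by lra.
have := hd r rab; rewrite xyd ?xr// => /(_ isT) h1; have h2 := hP r rab Pr.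
rewrite -[f s](subrKC (f r)) (le_trans (ler_normD _ _))// lerD// distrC.
exact: h1.
Qed.

(** After translation to the fixed segment from 0 to 1, the integrands are compared pointwise. *)
Lemma luc_integ J f : shift_closed J -> luc J f ->
  luc J (fun t => integ f t (t + 1)).
Proof.
move=> sJ lf B e e0; have [d d0 hd] := lf (B + 1) e e0.
exists d => // x y Jx Jy xB yB xyd.
have sh z : J z -> integ f z (z + 1) = integ (fun t => f (t + z)) 0 1.
  move=> Jz; rewrite integ_shift ?ler01// add0r 1?addrC//.
  exact: luc_cont_on lf Jz.
have cf z : J z -> cont_on (fun t => f (t + z)) 0 1.
  by move=> Jz; apply: cont_on_shift; rewrite add0r; exact: luc_cont_on lf Jz.
rewrite !sh// -[leRHS]mulr1 -[X in _ * X]subr0.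
apply: integ_dist => //; [exact: cf|exact: cf|].
move=> t /andP[t0 t1]; rewrite ![t + _]addrC; apply: hd; try exact: sJ.
- by rewrite (le_trans (ler_normD _ _))// lerD// ger0_norm.
- by rewrite (le_trans (ler_normD _ _))// lerD// ger0_norm.
- by rewrite (_ : _ - _ = x - y)//; ring.
Qed.

End FunctionClasses.

(** If no [A n] were dense in an interval of positive numbers, the open sets [U n] would all be
    dense in the line. A positive point of their intersection would belong to no [A n]. *)
Lemma baire_dense {R : realType} (A : nat -> set R) :
  (forall s, 0 < s -> exists n, A n s) ->
  exists n a b, [/\ 0 < a, a < b &
    forall x y, a <= x -> x < y -> y <= b -> exists2 s, x < s < y & A n s].
Proof.
move=> hA; apply: contrapT => no.
have {}no n a b : 0 < a -> a < b -> exists x y, [/\ a <= x, x < y, y <= b &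
    forall s, x < s < y -> ~ A n s].
  move=> a0 ab; apply: contrapT => no'; apply: no; exists n, a, b; split=> //.
  move=> x y ax xy yb; apply: contrapT => no''; apply: no'; exists x, y.
  by split=> // s xsy As; apply: no''; exists s.
(* The clause [0 < s] puts every negative point in [U n], so that Baire's theorem can be applied on
   the whole line. *)
pose U n := [set z : R | exists x y, x < z < y /\
  forall s, x < s < y -> 0 < s -> ~ A n s].
have Uop n : open (U n).
  rewrite openE => z [x [y [/andP[xz zy] hs]]].
  apply: filterS (_ : nbhs z `]x, y[%classic) => [w|]; last first.
    by apply: near_in_itvoo; rewrite in_itv/= xz.
  by rewrite /= in_itv/= => xwy; exists x, y.
have Ud n : dense (U n).
  move=> O [z Oz] oO; have /nbhs_ballP[e /= e0 he] := open_nbhs_nbhs (conj oO Oz).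
  have hO w : `|z - w| < e -> O w by move=> zw; apply: he; rewrite -ball_normE.
  have [ze|ze] := leP (z + e) 0.
    exists z; split=> //; exists (z - e), (z + e); split; first lra.
    by move=> s; lra.
  (* The left endpoint is positive because of [(z + e) / 2], and stays within [e] of [z] because of
     [z - e / 2]. *)
  have [|| x [y [ax xy yb hs]]] := no n (Num.max (z - e / 2) ((z + e) / 2)) (z + e).
  - by rewrite lt_max; apply/orP; right; lra.
  - by rewrite gt_max; lra.
  move: ax; rewrite ge_max => /andP[zx _].
  exists ((x + y) / 2); split; last first.
    by exists x, y; split; [lra | move=> s xsy _; exact: hs].
  by apply: hO; rewrite ltr_norml; lra.
have [|p [/= p0 pU]] := @Baire R R U (fun n => conj (Uop n) (Ud n))
    [set x | 0 < x] _ (@open_gt R 0).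
  by exists 1 => /=.
have [n Anp] := hA p p0; have [x [y [xpy /(_ p xpy p0)]]] := pU n I.
by apply.
Qed.

(** * Oscillation of the chirp *)

Section Chirp.
Context {R : realType} {X : completeNormedModType R}.
Let E : completeNormedModType R := (X * X)%type.
Implicit Types (J : set R) (f v : R -> E) (a b c e h t x y B C M : R).

Lemma luc_crot J (p : R -> R) f :
  (forall B x y, `|x| <= B -> `|y| <= B -> `|p x - p y| <= 2 * B * `|x - y|) ->
  luc J f -> luc J (fun t => crot (p t) (f t) : E).
Proof.
move=> hp lf B e e0.
have [B0|B0] := ltP B 0.
  by exists 1 => // x y _ _ xB; have := normr_ge0 x; lra.
have [C0 hC0] := luc_bounded B lf.
have [C C_gt0 hC] : exists2 C, 0 < C & forall t, J t -> `|t| <= B -> `|f t| <= C.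
  exists (Num.max C0 1); first by rewrite lt_max ltr01 orbT.
  by move=> t Jt tB; rewrite le_max hC0.
have e40 : 0 < e / 4 by lra.
have [d d0 hd] := lf B _ e40.
(* The change of phase contributes at most [4 * B * C * |x - y|], which is below [e / 2]; [B + 1]
   keeps [K] positive for [B = 0]. *)
pose K := 8 * (B + 1) * C; have K0 : 0 < K by rewrite /K; nra.
exists (Num.min d (e / K)); first by rewrite lt_min d0 divr_gt0.
move=> x y Jx Jy xB yB; rewrite lt_min => /andP[xyd]; rewrite ltr_pdivlMr// => xyK.
rewrite (_ : _ - _ = crot (p x) (f x - f y) + (crot (p x) (f y) - crot (p y) (f y))).
  rewrite (le_trans (ler_normD _ _))//.
  rewrite (le_trans (lerD (norm_crot _ _) (crot_lipschitz _ _ _)))//.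
  have h1 := hd _ _ Jx Jy xB yB xyd.
  have h2 := hC _ Jy yB; have h3 := hp _ _ _ xB yB.
  have : `|p x - p y| * `|f y| <= 2 * B * `|x - y| * C by apply: ler_pM.
  move: xyK; rewrite /K => xyK h4.
  have : 0 <= `|x - y| * C by rewrite mulr_ge0// ltW.
  by lra.
by rewrite crotB; module R.
Qed.

Lemma chirp_lipschitz B x y : `|x| <= B -> `|y| <= B ->
  `|x ^+ 2 - y ^+ 2| <= 2 * B * `|x - y|.
Proof.
move=> xB yB; rewrite subr_sqr normrM mulrC ler_wpM2r//.
by rewrite (le_trans (ler_normD _ _))//; lra.
Qed.

(** A shift by [pi / 2] reverses the sign of the factor in [k]. Since the increments of [k] and [w]
    over this shift are bounded, so is [2 w (t + 1)]; one more step of length 1 leads back to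
    [w t]. *)
Lemma modulated_bdd J (w k : R -> E) : shift_closed J -> uc J w -> uc J k ->
  (forall t, J t -> k t = crot (2 * t + 1) (w (t + 1))) -> bdd J w.
Proof.
move=> sJ uw uk kw; have c0 : 0 <= pi / 2 :> R by rewrite divr_ge0// pi_ge0.
have [C hC] := uc_step sJ c0 uk.
have [C1 hC1] := uc_step sJ c0 uw; have [C2 hC2] := uc_step sJ ler01 uw.
exists (C + C1 + C2) => t Jt.
have Jt1 : J (t + 1) by apply: sJ.
have := hC t Jt; rewrite !kw//; last exact: sJ.
have -> : 2 * (t + pi / 2) + 1 = 2 * t + 1 + pi by field.
have -> : t + pi / 2 + 1 = t + 1 + pi / 2 by ring.
rewrite crotDpi -opprD normrN -crotDr => h1.
have h2 := norm_crot (- (2 * t + 1)) (crot (2 * t + 1)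
  (w (t + 1 + pi / 2) + w (t + 1))).
rewrite crotK in h2.
have h3 := hC1 _ Jt1; have h4 := hC2 _ Jt.
have h5 : 2 * `|w (t + 1)| <= 2 * C + C1.
  have -> : 2 * `|w (t + 1)| = `|2 *: w (t + 1)| by rewrite normrZ ger0_norm.
  rewrite (_ : 2 *: w (t + 1) = (w (t + 1 + pi / 2) + w (t + 1)) -
    (w (t + 1 + pi / 2) - w (t + 1))); last by module R.
  by rewrite (le_trans (ler_normB _ _))//; lra.
rewrite (_ : w t = w (t + 1) - (w (t + 1) - w t)); last by module R.
rewrite (le_trans (ler_normB _ _))//.
by have := normr_ge0 (w (t + 1 + pi / 2) - w (t + 1)); lra.
Qed.

(** Sliding the window by [r] changes the integral only through two end pieces of length [r], yet
    nearly reverses its sign; hence twice the integral is small. *)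
Lemma chirp_integ_vanish J v f h : shift_closed J -> uc J v -> bdd J v ->
  0 <= h -> luc J f -> (forall t, J t -> f t = crot (t ^+ 2) (v t)) ->
  vanish J (fun t => integ f t (t + h)).
Proof.
move=> sJ uv bv h0 lf fE e e0; have [C C0 hC] := bdd_gt0 bv.
have [|d d0 hd] := uv (e / (2 * (h + 1))); first by rewrite divr_gt0//; lra.
(* [K * r] collects the errors of order [r]: the residual phase [q] integrated over the window, with
   [r ^+ 2 <= r], and the two end pieces. *)
pose K := (4 * h + 2) * C * h + 4 * C.
have K0 : 0 < K by rewrite /K; nra.
pose rho := Num.min d (Num.min 1 (e / K)).
have rho0 : 0 < rho by rewrite !lt_min d0 ltr01 divr_gt0.
have pi0 := pi_gt0 R.
exists (pi / (2 * rho)) => t Jt; rewrite ltr_pdivrMr; last by lra.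
move=> tM; have t0 : 0 < `|t| by nra.
pose r := pi / (2 * `|t|).
have r0 : 0 < r by rewrite divr_gt0//; lra.
have : r < rho by rewrite /r ltr_pdivrMr; lra.
rewrite !lt_min ltr_pdivlMr// => /and3P[rd r1 rK].
have nf s : J s -> `|f s| <= 2 * C.
  by move=> Js; rewrite fE// (le_trans (norm_crot _ _))// ler_pM2l// hC.
have flip s : t <= s <= t + h ->
    `|f (s + r) - (- f s)| <= e / (h + 1) + 2 * (2 * h * r + r ^+ 2) * C.
  move=> /andP[ts st]; have Js := shift_closed_le sJ Jt ts.
  have Jsr : J (s + r) by apply: sJ => //; exact: ltW.
  (* The part of [(s + r) ^+ 2 - s ^+ 2] left after removing [2 * t * r], which is [pi] or [- pi]
     according to the sign of [t]. *)
  pose q := 2 * (s - t) * r + r ^+ 2.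
  have q0 : 0 <= q by rewrite /q; nra.
  have -> : f (s + r) - (- f s) =
      - (crot (s ^+ 2 + q) (v (s + r)) - crot (s ^+ 2) (v s)).
    rewrite !fE// opprK opprB addrC; congr (_ + _).
    have [t_ge0|t_lt0] := leP 0 t.
      rewrite -crotDpi; congr crot; rewrite /q /r ger0_norm//.
      by field; rewrite gt_eqF//; move: t0; rewrite ger0_norm.
    rewrite -crotDNpi; congr crot; rewrite /q /r ltr0_norm//.
    by field; rewrite lt_eqF.
  rewrite normrN (_ : _ - _ = crot (s ^+ 2 + q) (v (s + r) - v s) +
    (crot (s ^+ 2 + q) (v s) - crot (s ^+ 2) (v s))); last by rewrite crotB; module R.
  rewrite (le_trans (ler_normD _ _))//.
  rewrite (le_trans (lerD (norm_crot _ _) (crot_lipschitz _ _ _)))// lerD//.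
    have : `|v (s + r) - v s| <= e / (2 * (h + 1)).
      by apply: hd => //; rewrite (_ : _ - _ = r) ?gtr0_norm//; ring.
    have -> : e / (h + 1) = 2 * (e / (2 * (h + 1))) by field; lra.
    by rewrite ler_pM2l.
  have -> : s ^+ 2 + q - s ^+ 2 = q by ring.
  rewrite (ger0_norm q0); apply: ler_pM => //; [by nra| |exact: hC].
  by rewrite /q; nra.
have cf a b : J a -> cont_on f a b by exact: luc_cont_on.
have Jr : J (t + r) by apply: sJ => //; exact: ltW.
have Jh : J (t + h) by apply: sJ.
have th : t <= t + h by lra.
have cfr : cont_on (fun s => f (s + r)) t (t + h).
  by apply: luc_cont_on Jt => //; apply: luc_shift => //; exact: ltW.
have cfN : cont_on (fun s => - f s) t (t + h).
  move=> s sth k k0; have [D D0 hD] := cf t (t + h) Jt s sth k k0.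
  by exists D => // x xth /(hD _ xth); rewrite -opprD normrN.
have := integ_dist th cfr cfN flip; rewrite integN; [|exact: th|exact: cf].
rewrite integ_shift; [|exact: th|exact: cf].
have e1 := @integ_chasles _ _ f t (t + r) (t + h + r).
have e2 := @integ_chasles _ _ f t (t + h) (t + h + r).
have b1 := @integ_bound _ _ (2 * C) f t (t + r).
have b2 := @integ_bound _ _ (2 * C) f (t + h) (t + h + r).
have {}b1 : `|integ f t (t + r)| <= 2 * C * r.
  rewrite -[X in _ * X](addrK t) [r + t]addrC; apply: b1; [lra|exact: cf|].
  by move=> s /andP[ts _]; apply/nf/(shift_closed_le sJ Jt ts).
have {}b2 : `|integ f (t + h) (t + h + r)| <= 2 * C * r.
  rewrite -[X in _ * X](addrK (t + h)) [r + _]addrC; apply: b2; [lra|exact: cf|].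
  by move=> s /andP[ts _]; apply/nf/(shift_closed_le sJ Jh ts).
have {e1 e2} e12 : integ f t (t + r) + integ f (t + r) (t + h + r) =
    integ f t (t + h) + integ f (t + h) (t + h + r).
  by rewrite -e1 -?e2//; try exact: cf; lra.
rewrite (_ : t + h - t = h); last by ring.
move=> b3.
suff : 2 * `|integ f t (t + h)| <= 2 * e by lra.
have -> : 2 * `|integ f t (t + h)| = `|2 *: integ f t (t + h)|.
  by rewrite normrZ ger0_norm.
rewrite (_ : 2 *: integ f t (t + h) =
  (integ f (t + r) (t + h + r) - - integ f t (t + h)) +
  (integ f t (t + r) - integ f (t + h) (t + h + r))); last first.
  rewrite (_ : integ f t (t + r) = integ f t (t + h) +
    integ f (t + h) (t + h + r) - integ f (t + r) (t + h + r)); first by module R.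
  by rewrite -e12; module R.
rewrite (le_trans (ler_normD _ _))//.
rewrite (le_trans (lerD b3 (ler_normB _ _)))//.
have : e / (h + 1) * h <= e.
  by rewrite mulrAC ler_pdivrMr; [nra|lra].
move: rK; rewrite /K => rK.
have : r * r <= r by nra.
move=> rr; have : r * r * (C * h) <= r * (C * h) by rewrite ler_wpM2r// mulr_ge0// ltW.
by move: b1 b2; lra.
Qed.

End Chirp.

(** * The decomposition *)

Section Decomposition.
Context {R : realType} {X : completeNormedModType R}.
Let E : completeNormedModType R := (X * X)%type.
Context (J : set R) (F : R -> E) (v : R -> R -> E).
Hypothesis sJ : shift_closed J.
Hypothesis uv : forall s, 0 < s -> uc J (v s).
Hypothesis FE : forall s t, 0 < s -> J t -> Delta s F t = crot (t ^+ 2) (v s t).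
Implicit Types (a b c e h l s t x y B C M : R).

(** The increments satisfy [Delta (s + 1) F t - Delta 1 F t = Delta s F (t + 1)]. Dividing by the
    chirp at [t] leaves the phase [(t + 1) ^+ 2 - t ^+ 2 = 2 * t + 1], as [modulated_bdd]
    requires. *)
Lemma cocycle_bdd s : 0 < s -> bdd J (v s).
Proof.
move=> s0; have s10 : 0 < s + 1 by lra.
apply: (@modulated_bdd _ _ _ _ (fun t => v (s + 1) t - v 1 t) sJ (uv s0)).
  move=> e e0; have e20 : 0 < e / 2 by lra.
  have [d d0 hd] := uv s10 e20; have [d' d'0 hd'] := uv ltr01 e20.
  exists (Num.min d d'); first by rewrite lt_min d0.
  move=> x y Jx Jy; rewrite lt_min => /andP[/(hd _ _ Jx Jy) h1 /(hd' _ _ Jx Jy) h2].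
  rewrite (_ : _ - _ = (v (s + 1) x - v (s + 1) y) - (v 1 x - v 1 y)).
    by rewrite (le_trans (ler_normB _ _))//; lra.
  by module R.
move=> t Jt; have Jt1 : J (t + 1) by apply: sJ.
rewrite -[LHS](crotK (t ^+ 2)) -[RHS](crotK (t ^+ 2)); congr crot.
rewrite crotD crotB -!FE//.
rewrite (_ : t ^+ 2 + (2 * t + 1) = (t + 1) ^+ 2); last by ring.
rewrite -FE// /Delta (_ : t + (s + 1) = t + 1 + s); last by ring.
by module R.
Qed.

Lemma Delta_luc s : 0 < s -> luc J (Delta s F).
Proof.
move=> s0; have := luc_crot (@chirp_lipschitz R) (uc_luc (uv s0)).
by apply: eq_luc => t Jt; rewrite FE.
Qed.

Lemma Delta_cont_on s a b : 0 < s -> J a -> cont_on (Delta s F) a b.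
Proof. by move=> s0; apply: luc_cont_on => //; exact: Delta_luc. Qed.

Lemma Delta_integ_vanish s h : 0 < s -> 0 <= h ->
  vanish J (fun t => integ (Delta s F) t (t + h)).
Proof.
move=> s0 h0; apply: (chirp_integ_vanish sJ (uv s0) (cocycle_bdd s0) h0).
  exact: Delta_luc.
by move=> t; exact: FE.
Qed.

Let Delta_integ_step s h t t' : 0 < s -> 0 < h -> J t -> t <= t' ->
  integ (Delta s F) t (t + h) - integ (Delta s F) t' (t' + h) =
  integ (fun x => Delta s F x - Delta s F (x + h)) t t'.
Proof.
move=> s0 h0 Jt tt'; have Jt' := shift_closed_le sJ Jt tt'.
have cD a b : J a -> cont_on (Delta s F) a b by exact: Delta_cont_on.
have Jth : J (t + h) by apply: sJ => //; exact: ltW.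
have e1 := @integ_chasles _ _ (Delta s F) t (t + h) (t' + h).
have e2 := @integ_chasles _ _ (Delta s F) t t' (t' + h).
rewrite (@integB _ _ (Delta s F) (fun x => Delta s F (x + h)));
  [|exact: tt'|exact: cD|]; last first.
  apply: luc_cont_on Jt => //.
  by apply: luc_shift; [exact: sJ|exact: ltW|exact: Delta_luc].
rewrite (@integ_shift _ _ h (Delta s F)); [|exact: tt'|exact: cD].
have : integ (Delta s F) t (t + h) + integ (Delta s F) (t + h) (t' + h) =
  integ (Delta s F) t t' + integ (Delta s F) t' (t' + h).
  by rewrite -e1 -?e2//; try exact: cD; lra.
move=> /(canRL (addrK _)) ->.
by module R.
Qed.

(* The difference of both sides does not depend on [t], because the mixed
   differences commute, and it vanishes at infinity. *)
Lemma Delta_integ_swap h l t : 0 < h -> 0 < l -> J t ->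
  integ (Delta h F) t (t + l) = integ (Delta l F) t (t + h).
Proof.
move=> h0 l0 Jt; apply/eqP; rewrite -subr_eq0 -normr_le0.
apply/ler_addgt0Pr => e e0; rewrite add0r; have e20 : 0 < e / 2 by lra.
have [M hM] := Delta_integ_vanish h0 (ltW l0) e20.
have [M' hM'] := Delta_integ_vanish l0 (ltW h0) e20.
(* A point to the right of [t] beyond both thresholds, whatever the sign of [t]. *)
pose t' := t + (`|t| + `|M| + `|M'| + 1).
have tt' : t <= t'.
  by rewrite lerDl; have := normr_ge0 t; have := normr_ge0 M; have := normr_ge0 M'; lra.
have Jt' := shift_closed_le sJ Jt tt'.
have t'M : `|M| + `|M'| < `|t'|.
  have := ler_norm t'; have := ler_norm (- t); rewrite normrN /t'; lra.
have Mt' : M < `|t'| by have := ler_norm M; have := normr_ge0 M'; lra.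
have M't' : M' < `|t'| by have := ler_norm M'; have := normr_ge0 M; lra.
have s1 := Delta_integ_step h0 l0 Jt tt'; have s2 := Delta_integ_step l0 h0 Jt tt'.
have s12 : integ (fun x => Delta h F x - Delta h F (x + l)) t t' =
    integ (fun x => Delta l F x - Delta l F (x + h)) t t'.
  apply: eq_integ => //.
    apply: luc_cont_on Jt => //; apply: lucB; first exact: Delta_luc.
    by apply: luc_shift; [exact: sJ|exact: ltW|exact: Delta_luc].
  by move=> x _; rewrite /Delta (addrAC x h l); module R.
rewrite (_ : _ - _ = integ (Delta h F) t' (t' + l) - integ (Delta l F) t' (t' + h)).
  rewrite (le_trans (ler_normB _ _))//.
  by have := hM _ Jt' Mt'; have := hM' _ Jt' M't'; lra.
move: s1 s2; rewrite s12 => /(canRL (subrK _)) -> /(canRL (subrK _)) ->.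
by module R.
Qed.

(* By Baire, the bounds on [v s] are uniform on a dense set of [s] in some
   interval, although nothing is assumed on the dependence of [v s] on [s]. *)
Lemma cocycle_equicontinuous e : 0 < e -> exists C d a b,
  [/\ 0 < C, 0 < d, 0 < a & a < b] /\
  forall x y, a <= x -> x < y -> y <= b -> exists2 s, x < s < y &
    (forall t, J t -> `|v s t| <= C) /\
    (forall t t', J t -> J t' -> `|t - t'| < d -> `|v s t - v s t'| <= e).
Proof.
move=> e0.
(* One index gives both the bound and the inverse modulus, so the sets [A n] cover the positive
   numbers. *)
pose A (n : nat) := [set s | (forall t, J t -> `|v s t| <= n.+1%:R) /\
  (forall t t', J t -> J t' -> `|t - t'| < n.+1%:R^-1 -> `|v s t - v s t'| <= e)].
have [s s0|n [a [b [a0 ab hd]]]] := @baire_dense R A.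
  have [C C0 hC] := bdd_gt0 (cocycle_bdd s0); have [d d0 hd] := uv s0 e0.
  have [N hN] := natSinv_lt d0.
  exists (maxn N (Num.truncn C)); split=> [t Jt|t t' Jt Jt' tt'].
    rewrite (le_trans (hC _ Jt))// ltW// (lt_le_trans (truncnS_gt _))//.
    by rewrite ler_nat ltnS leq_maxr.
  by apply: hd => //; rewrite (lt_trans tt')// hN// leq_maxl.
exists n.+1%:R, n.+1%:R^-1, a, b; split; last exact: hd.
by split=> //; rewrite ?invr_gt0.
Qed.

(** [Delta h F] is continuous before [F] is known to be. For small [h] its increments over [s] in
    the Baire interval are small, first for a dense set of [s], then for all. So [Delta h F x] is
    close to its mean over a translate of that interval, and this mean is small because
    [Delta_integ_swap] turns it into an integral over length [h]. *)
Lemma cocycle_luc : luc J F.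
Proof.
move=> B e e0; have e40 : 0 < e / 4 by lra.
have [C [d [a [b [[C0 d0 a0 ab] dns]]]]] := cocycle_equicontinuous e40.
pose l := b - a; have l0 : 0 < l by rewrite subr_gt0.
have [Cl Cl0 hCl] := bdd_gt0 (cocycle_bdd l0).
pose K := 2 * (2 * (`|B| + 1)) * C; have K0 : 0 < K.
  by rewrite /K; have := normr_ge0 B; nra.
(* In order: equicontinuity of [v s], staying within [|B| + 1], the change of the chirp, and the
   swapped integral of [Delta l F]. *)
pose h0 := Num.min (Num.min d 1) (Num.min (e / 4 / K) (e / 4 * l / (2 * Cl))).
exists h0; first by rewrite !lt_min d0 ltr01 !divr_gt0// ?mulr_gt0.
suff key x h : J x -> `|x| <= B -> 0 < h -> h < h0 -> `|F (x + h) - F x| <= e.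
  move=> x y Jx Jy xB yB; have [xy|yx|->] := ltgtP x y.
  - rewrite (distrC x) gtr0_norm ?subr_gt0// => xyh.
    by rewrite distrC -{1}(subrKC x y); apply: key; rewrite ?subr_gt0.
  - rewrite gtr0_norm ?subr_gt0// => xyh.
    by rewrite -{1}(subrKC y x); apply: key; rewrite ?subr_gt0.
  - by move=> _; rewrite subrr normr0 ltW.
move=> Jx xB hp; rewrite !lt_min => /andP[/andP[hd h1] /andP[]].
rewrite ltr_pdivlMr// => hK; rewrite ltr_pdivlMr; last by lra.
move=> hCl2.
have pt z : a <= z <= b -> `|Delta h F (x + z) - Delta h F x| <= 3 * (e / 4).
  apply: (@norm_le_dense _ _ _ _ (fun s => Delta h F (x + s) - Delta h F x) _ _ ab _ dns).
    move=> r rab k k0; have [|D D0 hD] := Delta_cont_on hp Jx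
      (a := x) (b := x + b) (t := x + r) _ k0; first by lra.
    exists D => // r' r'ab rr'.
    rewrite (_ : _ - _ = Delta h F (x + r') - Delta h F (x + r)).
      by apply: hD; [lra|rewrite (_ : _ - _ = r' - r)//; ring].
    by module R.
  move=> s /andP[as_ sb] [vC ve]; have s0 : 0 < s by lra.
  have Jxh : J (x + h) by apply: sJ => //; exact: ltW.
  rewrite (_ : _ - _ = Delta s F (x + h) - Delta s F x); last first.
    by rewrite /Delta (addrAC x h s); module R.
  rewrite !FE// (_ : _ - _ = crot ((x + h) ^+ 2) (v s (x + h) - v s x) +
    (crot ((x + h) ^+ 2) (v s x) - crot (x ^+ 2) (v s x))); last first.
    by rewrite crotB; module R.
  rewrite (le_trans (ler_normD _ _))//.
  rewrite (le_trans (lerD (norm_crot _ _) (crot_lipschitz _ _ _)))//.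
  have xhx : x + h - x = h by ring.
  have := ve _ _ Jxh Jx; rewrite xhx gtr0_norm// => /(_ hd) h2.
  have h3 := vC _ Jx.
  have : `|(x + h) ^+ 2 - x ^+ 2| <= 2 * (`|B| + 1) * `|x + h - x|.
    apply: chirp_lipschitz; have := ler_norm B; last by lra.
    by have := ler_normD x h; rewrite (gtr0_norm hp); lra.
  rewrite xhx (gtr0_norm hp) => h4.
  have : `|(x + h) ^+ 2 - x ^+ 2| * `|v s x| <= 2 * (`|B| + 1) * h * C.
    by apply: ler_pM.
  by move: hK; rewrite /K; lra.
have Jxa : J (x + a) by apply: sJ => //; exact: ltW.
have xab : x + a <= x + b by lra.
have i1 := @integ_dist _ _ (3 * (e / 4)) (Delta h F) (fun=> Delta h F x) _ _ xab
  (Delta_cont_on hp Jxa).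
have {}i1 : `|integ (Delta h F) (x + a) (x + b) - l *: Delta h F x| <= 3 * (e / 4) * l.
  move: i1; rewrite integ_cst// (_ : x + b - (x + a) = l); last by rewrite /l; ring.
  apply.
    by move=> t _ k k0; exists 1 => // s _ _; rewrite subrr normr0 ltW.
  move=> t txab; rewrite -(subrKC x t); apply: pt; lra.
have i2 : `|integ (Delta h F) (x + a) (x + b)| <= e / 4 * l.
  rewrite (_ : x + b = x + a + l); last by rewrite /l; ring.
  rewrite Delta_integ_swap//.
  apply: (@le_trans _ _ (2 * Cl * (x + a + h - (x + a)))).
    apply: integ_bound; [lra|exact: Delta_cont_on|].
    move=> t /andP[xat _]; have Jt := shift_closed_le sJ Jxa xat.
    by rewrite FE// (le_trans (norm_crot _ _))// ler_pM2l// hCl.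
  by rewrite (_ : _ - _ = h); [lra|ring].
rewrite -/(Delta h F x) -(ler_pM2l l0).
have -> : l * `|Delta h F x| = `|l *: Delta h F x| by rewrite normrZ gtr0_norm.
rewrite -(subKr (integ (Delta h F) (x + a) (x + b)) (l *: _)).
rewrite (le_trans (ler_normB _ _))//.
by lra.
Qed.

Let cF a b : J a -> cont_on F a b.
Proof. by apply: luc_cont_on => //; exact: cocycle_luc. Qed.

Lemma Delta_integE h t c : J t -> 0 <= h -> 0 <= c ->
  integ F (t + h) (t + h + c) - integ F t (t + c) = integ (Delta h F) t (t + c).
Proof.
move=> Jt h0 c0; have tc : t <= t + c by lra.
rewrite /Delta (@integB _ _ (fun x => F (x + h)) F)//; last exact: cF.
  by rewrite (@integ_shift _ _ h F)// ?(addrAC t c h)//; apply: cF; exact: sJ.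
by apply: cont_on_shift; apply: cF; exact: sJ.
Qed.

(** Consecutive windows of length [l] carry the same integral up to o(1), since their differences
    are integrals of some [Delta s F]. *)
Lemma integ_mul_vanish l j : 0 < l -> vanish J (fun t =>
  integ F t (t + j.+1%:R * l) - j.+1%:R *: integ F t (t + l)).
Proof.
move=> l0; elim: j => [e e0|j ih].
  by exists 0 => t _ _; rewrite mul1r scale1r subrr normr0 ltW.
have jl0 : 0 < j.+1%:R * l by rewrite mulr_gt0.
apply: eq_vanish (vanishB ih (vanishN
  (Delta_integ_vanish jl0 (ltW l0)))) => t Jt.
rewrite -Delta_integE//; try exact: ltW.
rewrite (@integ_chasles _ _ F t (t + j.+1%:R * l) (t + j.+2%:R * l)).
- have j2 : j.+2%:R = j.+1%:R + 1 :> R by rewrite natr1.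
  rewrite (_ : t + j.+2%:R * l = t + j.+1%:R * l + l) j2; last by ring.
  by module R.
- by lra.
- by rewrite lerD2l; apply: ler_wpM2r; [exact: ltW|rewrite ler_nat].
- exact: cF.
Qed.

(** The unit window is first moved by [a], at the cost of an integral of [Delta a F], and then cut
    into [k.+1] equal windows. *)
Lemma mean_vanish a k : 0 < a -> vanish J (fun t =>
  integ F t (t + 1) - k.+1%:R *: integ F (t + a) (t + a + k.+1%:R^-1)).
Proof.
move=> a0; have k0 : 0 < k.+1%:R^-1 :> R by rewrite invr_gt0.
have v1 := vanish_shift sJ (ltW a0) (integ_mul_vanish k k0).
apply: eq_vanish (vanishB v1 (Delta_integ_vanish a0 ler01)) => t Jt.
rewrite mulfV ?pnatr_eq0// -Delta_integE ?ler01//; last exact: ltW.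
by module R.
Qed.

Let chirp_quotient (f : R -> E) t : E := crot (- t ^+ 2) (f t).

(** The quotient is minus the mean of [v s t] over [s] from [a] to [a + 1/(k+1)]. This window lies
    in the Baire interval, so the bound and the modulus of [v s] pass to the mean. *)
Lemma short_mean_uniform e : 0 < e -> exists C d a k,
  [/\ 0 < d, 0 < a,
    forall t, J t -> `|chirp_quotient (fun t => F t -
      k.+1%:R *: integ F (t + a) (t + a + k.+1%:R^-1)) t| <= C &
    forall t t', J t -> J t' -> `|t - t'| < d ->
      `|chirp_quotient (fun t => F t -
          k.+1%:R *: integ F (t + a) (t + a + k.+1%:R^-1)) t -
        chirp_quotient (fun t => F t -
          k.+1%:R *: integ F (t + a) (t + a + k.+1%:R^-1)) t'| <= e].
Proof.
move=> e0.
have [C [d [a [b [[C0 d0 a0 ab] dns]]]]] := cocycle_equicontinuous e0.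
have [|k hk] := @natSinv_lt R (b - a); first by rewrite subr_gt0.
have {}hk := hk _ (leqnn k); pose l : R := k.+1%:R^-1.
have l0 : 0 < l by rewrite invr_gt0.
have lb : a + l <= b by move: hk; rewrite -/l; lra.
have al : a <= a + l by lra.
have {}dns x y : a <= x -> x < y -> y <= a + l -> exists2 s, x < s < y &
    (forall t, J t -> `|v s t| <= C) /\
    (forall t t', J t -> J t' -> `|t - t'| < d -> `|v s t - v s t'| <= e).
  by move=> ax xy yl; apply: dns => //; exact: le_trans lb.
(* This is [v s t] written through [F], whose continuity gives continuity in [s]. *)
pose W t s : E := crot (- t ^+ 2) (F (s + t) - F t).
have Wv t s : J t -> 0 < s -> W t s = v s t.
  by move=> Jt s0; rewrite /W -[v s t](crotK (t ^+ 2)) -FE// /Delta (addrC t).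
have cFs t : J t -> cont_on (fun s => F (s + t) - F t) a (a + l).
  move=> Jt; apply: cont_onB; last exact: cont_on_cst.
  by apply: cont_on_shift; apply: cF; rewrite addrC; apply: sJ => //; exact: ltW.
have cW t : J t -> cont_on (W t) a (a + l).
  move=> Jt; apply: (@cont_on_lipschitz _ _ (crot (- t ^+ 2)) 2) (cFs t Jt) => //.
  by move=> x y; rewrite -crotB; exact: norm_crot.
have WC t s : J t -> a <= s <= a + l -> `|W t s| <= C.
  move=> Jt; apply: (norm_le_dense _ (cW t Jt) dns); first by lra.
  by move=> r /andP[ar _] [h _]; rewrite Wv//; [exact: h|lra].
have We t t' s : J t -> J t' -> `|t - t'| < d -> a <= s <= a + l ->
    `|W t s - W t' s| <= e.
  move=> Jt Jt' tt'.
  apply: (norm_le_dense _ (cont_onB (cW t Jt) (cW t' Jt')) dns); first by lra.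
  by move=> r /andP[ar _] [_ h]; rewrite !Wv//; [exact: h|lra|lra].
have WE t : J t -> chirp_quotient (fun t => F t -
    k.+1%:R *: integ F (t + a) (t + a + k.+1%:R^-1)) t =
    - (k.+1%:R *: integ (W t) a (a + l)).
  move=> Jt; have Jta : J (t + a) by apply: sJ => //; exact: ltW.
  rewrite (@integ_linear _ _ (crot (- t ^+ 2)) 2 (fun s => F (s + t) - F t))//.
  - rewrite integB//; last exact: cont_on_cst.
      rewrite integ_shift//; last by rewrite addrC; exact: cF.
      rewrite integ_cst// /chirp_quotient -/l (addrC a t) (addrAC a l t) (addrC a t).
      rewrite -crotZ (_ : a + l - a = l); last by ring.
      rewrite [in RHS]scalerBr scalerA mulfV ?scale1r ?pnatr_eq0//.
      by rewrite !crotB opprB.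
    by apply: cont_on_shift; rewrite addrC; exact: cF.
  - exact: cFs.
  - by move=> x y; exact: crotB.
  - by move=> r x; exact: crotZ.
  - by move=> x; exact: norm_crot.
have kl c : c = k.+1%:R * (c * (a + l - a)).
  by rewrite [a + l]addrC addrK mulrCA mulfV ?pnatr_eq0// mulr1.
exists C, d, a, k; split=> //.
- move=> t Jt; rewrite WE// normrN normrZ ger0_norm//.
  rewrite (kl C) ler_pM2l//.
  by apply: integ_bound; [exact: al|exact: cW|move=> s; exact: WC].
- move=> t t' Jt Jt' tt'; rewrite !WE// -opprD normrN -scalerBr normrZ ger0_norm//.
  rewrite (kl e) ler_pM2l//.
  by apply: integ_dist; [exact: al|exact: cW|exact: cW|move=> s; exact: We].
Qed.

Lemma mean_quotient_luc :
  luc J (chirp_quotient (fun t => F t - integ F t (t + 1))).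
Proof.
apply: luc_crot; last by apply: lucB; [|apply: luc_integ => //]; exact: cocycle_luc.
by move=> B x y xB yB; rewrite -opprD normrN; exact: chirp_lipschitz.
Qed.

(** Far out, [u] is within [2 * e] of a short mean [w] with the required bounds; on bounded parts
    [mean_quotient_luc] suffices. *)
Lemma mean_quotient_uc_bdd :
  let u := chirp_quotient (fun t => F t - integ F t (t + 1)) in
  uc J u /\ bdd J u.
Proof.
move=> u.
have split_u e : 0 < e -> exists C d M (w : R -> E),
    [/\ 0 < d, forall t, J t -> `|w t| <= C,
      forall t t', J t -> J t' -> `|t - t'| < d -> `|w t - w t'| <= e &
      forall t, J t -> M < `|t| -> `|u t - w t| <= 2 * e].
  move=> e0; have [C [d [a [k [d0 a0 hC hd]]]]] := short_mean_uniform e0.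
  have [M hM] := mean_vanish k a0 e0.
  exists C, d, M, (chirp_quotient (fun t => F t -
      k.+1%:R *: integ F (t + a) (t + a + k.+1%:R^-1))); split=> // t Jt Mt.
  rewrite /u /chirp_quotient -crotB (le_trans (norm_crot _ _))// ler_pM2l//.
  rewrite -normrN; apply: le_trans (hM t Jt Mt).
  by rewrite le_eqVlt; apply/orP; left; apply/eqP; congr (`|_|); module R.
split=> [e e0|].
  have e60 : 0 < e / 6 by lra.
  have [C [d [M [w [d0 _ wd wM]]]]] := split_u _ e60.
  (* If one of two points less than 1 apart lies within [M], both lie within [|M| + 1]. *)
  have [d' d'0 hd'] := mean_quotient_luc (`|M| + 1) e0.
  exists (Num.min d (Num.min d' 1)); first by rewrite !lt_min d0 d'0 ltr01.
  move=> x y Jx Jy; rewrite !lt_min => /and3P[xyd xyd' xy1].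
  have Mn := ler_norm M.
  have far t t' : `|t - t'| < 1 -> `|t| <= M -> `|t'| <= `|M| + 1.
    move=> tt' tM; rewrite -(subrKC t t') (le_trans (ler_normD _ _))//.
    by rewrite distrC; lra.
  have [xM|Mx] := leP `|x| M.
    by apply: hd' => //; [lra|exact: far xM].
  have [yM|My] := leP `|y| M.
    by apply: hd' => //; [apply: far yM; rewrite distrC|lra].
  rewrite (_ : u x - u y = (w x - w y) + (u x - w x) - (u y - w y)); last by module R.
  rewrite (le_trans (ler_normB _ _))// (le_trans (lerD (ler_normD _ _) (lexx _)))//.
  by have := wd _ _ Jx Jy xyd; have := wM _ Jx Mx; have := wM _ Jy My; lra.
have [C [d [M [w [_ wC _ wM]]]]] := split_u _ ltr01.
have [C' hC'] := luc_bounded M mean_quotient_luc.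
exists (Num.max C' (C + 2)) => t Jt; rewrite le_max.
have [tM|Mt] := leP `|t| M; first by rewrite hC'.
rewrite (_ : u t = w t + (u t - w t)); last by module R.
apply/orP; right; rewrite (le_trans (ler_normD _ _))//.
by have := wC _ Jt; have := wM _ Jt Mt; lra.
Qed.

End Decomposition.

(** * From epsilon-delta classes to the spaces of the statement *)

Section Conversions.
Context {R : realType}.

Lemma UCP (V : completeNormedModType R) (J : set R) (f : R -> V) :
  UC J f <-> uc J f.
Proof.
rewrite /UC unif_continuousP; split=> [h e e0|h e e0].
  have [d d0 hd] := h e e0; exists d => // x y Jx Jy xyd.
  have := hd (x, y); rewrite /= ball_subspace_ball /subspace_ball mem_set//=.
  rewrite -!ball_normE /= => hxy; apply: ltW; apply: hxy.
  by split.
have e20 : 0 < e / 2 by rewrite divr_gt0.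
have [d d0 hd] := h _ e20; exists d => //= -[x y].
rewrite /= ball_subspace_ball /subspace_ball; case: ifPn => /=.
  move=> /set_mem Jx [Jy]; rewrite -!ball_normE /= => xyd.
  by rewrite (le_lt_trans (hd _ _ Jx Jy xyd))//; lra.
by move=> _ ->; exact: ballxx.
Qed.

Lemma bdd_bounded (V : normedModType R) (J : set R) (f : R -> V) :
  (exists C, forall t, J t -> `|f t| <= C) -> [bounded f t | t in J].
Proof.
move=> [C hC]; exists C; split; first exact: num_real.
by move=> M CM t /hC /le_trans; apply; exact: ltW.
Qed.

Lemma luc_continuous (V : completeNormedModType R) (f : R -> V) :
  luc setT f -> continuous f.
Proof.
move=> lf x; apply/cvgrPdist_le => e e0.
have [d d0 hd] := lf (`|x| + 1) e e0.
apply/nbhs_ballP; exists (Num.min d 1) => /=; first by rewrite lt_min d0 ltr01.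
move=> t /=; rewrite lt_min => /andP[xtd xt1]; apply: hd => //.
  by rewrite lerDl.
by rewrite -(subrKC x t) (le_trans (ler_normD _ _))// lerD2l distrC ltW.
Qed.

(** Sampling [f] on a grid of mesh [1/(n+1)] from [-(n+1)] to [n+1] gives simple functions
    converging pointwise to [f]. *)
Lemma continuous_L1loc (V : normedModType R) (J : set R) (f : R -> V) :
  continuous f -> L1loc J f.
Proof.
move=> cf; split; last first.
  move=> K cK _.
  have /integrableP[_] : lebesgue_measure.-integrable K (EFin \o (fun t => `|f t|)).
    apply: continuous_compact_integrable => //; apply: continuous_subspaceT.
    by move=> x; apply: continuous_comp; [exact: cf|exact: norm_continuous].
  by under eq_integral do rewrite /= normr_id.
(* The grid index of [t]: truncation sends everything left of the grid to 0, and the later minimum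
   with [N n] caps it on the right. *)
pose m n (t : R) := Num.truncn ((t + n.+1%:R) * n.+1%:R).
pose g n i := f (i%:R / n.+1%:R - n.+1%:R).
pose N n := (2 * n.+1 * n.+1)%N.
exists (fun n t => g n (minn (m n t) (N n))); split=> [n|].
  split.
    apply: (@sub_finite_set _ _ (g n @` `I_(N n).+1)).
      by move=> _ [t _ <-]; exists (minn (m n t) (N n)) => //=; rewrite ltnS geq_minr.
    exact/finite_image/finite_II.
  move=> y.
  rewrite (_ : _ @^-1` _ = \bigcup_(j in [set j | g n (minn j (N n)) = y])
    (m n @^-1` [set j])); last first.
    apply/seteqP; split=> [t /= <-|t [j /= <- <-]//].
    by exists (m n t).
  apply: bigcup_measurable => j _.
  (* The level sets of the monotone index are intervals. *)
  suff /is_intervalP -> : is_interval (m n @^-1` [set j]) by exact: measurable_itv.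
  move=> a b /= aj bj c /andP[ac cb].
  have mono x z : x <= z -> (m n x <= m n z)%N.
    by move=> xz; apply: le_truncn; rewrite ler_wpM2r// lerD2r.
  by apply/eqP; rewrite eqn_leq -{1}bj -aj !mono.
apply: aeW => t _.
suff : (minn (m n t) (N n))%:R / n.+1%:R - n.+1%:R @[n --> \oo] --> t.
  by move=> h; exact: (cvg_comp _ _ h (cf t)).
apply/cvgrPdist_lt => e e0.
have [K hK] := natSinv_lt e0.
exists (maxn K (Num.truncn `|t|)) => // n /=; rewrite geq_max => /andP[Kn tn].
have n0 : 0 < n.+1%:R :> R by rewrite ltr0n.
have tn1 : `|t| < n.+1%:R by rewrite (lt_le_trans (truncnS_gt _))// ler_nat.
have /andP[tl tr] : - n.+1%:R < t < n.+1%:R by rewrite -ltr_norml.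
have tn0 : 0 <= (t + n.+1%:R) * n.+1%:R by rewrite mulr_ge0//; lra.
have /andP[lo hi] := truncn_itv tn0.
have mN : (m n t <= N n)%N.
  rewrite -(@ler_nat R) (le_trans lo)// /N -mulnA mul2n -addnn natrD natrM.
  by rewrite -mulrDl ler_wpM2r//; lra.
rewrite (minn_idPl mN); apply: le_lt_trans (hK _ Kn).
rewrite -[leRHS]mul1r ler_pdivlMr//.
rewrite -[X in _ * X](gtr0_norm n0) -normrM.
rewrite (_ : _ * _ = (t + n.+1%:R) * n.+1%:R - (m n t)%:R); last first.
  by field; rewrite gt_eqF.
by rewrite ler_norml; move: lo hi; rewrite -/(m n t) -natr1; lra.
Qed.

End Conversions.

(** * Assembling [u] and [xi] from an extension of [phi] to the line *)

Unset Implicit Arguments.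
Set Strict Implicit.

Theorem lemma3p4 (R : realType) (X : completeNormedModType R) (J : set R)
    (hJ : J = `[0, +oo[%classic \/ J = [set: R]) (phi : R -> X * X)
    (hphi : forall s : R, 0 < s ->
       chirpUC J (Delta s (fun t => chirp t *c: phi t))) :
  exists u xi : R -> X * X,
    [/\ BUC J u, DeltaC0 J xi &
        forall t, J t -> phi t = u t + (chirp t)^-1 *c: xi t].
Proof.
have sJ : shift_closed J.
  case: hJ => -> t s //=; rewrite !in_itv/= !andbT; lra.
(* Extending [phi] by a retraction onto [J] makes the primitives below defined,
   and continuous, on the whole line. *)
have [p [pJ pid plip pnorm]] : exists p : R -> R, [/\ forall t, J (p t),
    forall t, J t -> p t = t, forall x y, `|p x - p y| <= `|x - y| &
    forall x, `|p x| <= `|x|].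
  case: hJ => ->; last by exists id.
  exists (Num.max 0); split=> [t|t|x y|x]; rewrite /= ?in_itv/= ?andbT.
  - by rewrite le_max lexx.
  - by move=> t0; rewrite max_r.
  - have := ler_norm (x - y); have := ler_norm (y - x); rewrite (distrC y x).
    by case: (leP 0 x); case: (leP 0 y) => *; rewrite ler_norml; lra.
  - by case: (leP 0 x) => //; rewrite normr0.
(* The functions are chosen independently for each [s], with no requirement when [s <= 0]. *)
have /choice[v hv] : forall s : R, exists v : R -> X * X, 0 < s -> uc J v /\
    forall t, J t -> Delta s (fun t => chirp t *c: phi t) t = crot (t ^+ 2) (v t).
  move=> s; have [s0|s0] := ltP 0 s; last by exists (fun=> 0).
  by have [w /UCP uw hw] := hphi s s0; exists w.
pose F t : X * X := chirp (p t) *c: phi (p t).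
have FE s t : 0 < s -> J t -> Delta s F t = crot (t ^+ 2) (v s t).
  move=> s0 Jt; rewrite -(hv s s0).2// /Delta /F !pid//.
  by apply: sJ => //; exact: ltW.
have uv s : 0 < s -> uc J (v s) by move=> /hv[].
have lF : luc J F := cocycle_luc sJ uv FE.
(* [F] factors through [p], which increases neither distances nor absolute values, so a modulus on
   [J] serves on the line. *)
have lFT : luc setT F.
  move=> B e e0; have [d d0 hd] := lF B e e0; exists d => // x y _ _ xB yB xyd.
  have Fp z : F z = F (p z) by rewrite /F (pid (p z)).
  rewrite Fp (Fp y); apply: hd => //; first exact: le_trans xB.
    exact: le_trans yB.
  exact: le_lt_trans xyd.
pose xi t : X * X := integ F t (t + 1).
have cxi : continuous xi by apply/luc_continuous/luc_integ.
have [uu bu] := mean_quotient_uc_bdd sJ uv FE.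
exists (fun t => crot (- t ^+ 2) (F t - xi t)), xi; split.
- by split; [exact/UCP|exact: bdd_bounded].
- split; first exact: continuous_L1loc.
  move=> h h0; split.
    apply: continuous_subspaceT => t; apply: cvgB; last exact: cxi.
    have th : (x + h) @[x --> t] --> t + h by apply: cvgD; [exact: cvg_id|exact: cvg_cst].
    exact: cvg_comp th (cxi _).
  (* Halving turns the weak inequality of [vanish] into the strict one of [C0]. *)
  move=> e e0; have e20 : 0 < e / 2 by rewrite divr_gt0.
  have [M hM] := Delta_integ_vanish sJ uv FE h0 ler01 e20.
  exists M => t Jt Mt; apply: le_lt_trans (_ : e / 2 < e); last by lra.
  rewrite /Delta /xi (Delta_integE sJ uv FE)//; [exact: hM|exact: ltW].
- move=> t Jt; rewrite chirpVE -crotDr subrK /F pid//.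
  by rewrite -[LHS](crotK (t ^+ 2)).
Qed.
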